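(* The expected values $E_N^{lin-exp}$ and $E_N^{lin-exp-sym}$ of the $N$th exponential linear complexity and of its symmetric version satisfy $$E_N^{lin-exp-sym}\le E_N^{lin-exp}-\frac{3N}{4}+O(1).$$ That is, there is an absolute constant $C$ such that $E_N^{lin-exp-sym}\le E_N^{lin-exp}-\frac{3N}{4}+C$ for all positive integers $N$.
   Context: For a binary vector $\mathcal{S}_N=(s_0,\ldots,s_{N-1})\in\{0,1\}^N$, regarded over the field $\mathbb{F}_2$, the $N$th linear complexity $L(\mathcal{S}_N)$ is the smallest integer $L\ge 0$ for which there are $c_0,\ldots,c_L\in\mathbb{F}_2$ with $c_L=1$ such that $$\sum_{\ell=0}^L c_\ell s_{n+\ell}=0,\quad n=0,1,\ldots,N-L-1$$ (the condition is vacuous for $L=N$; the zero vector has $L=0$). The reverse of $\mathcal{S}_N$ is $\mathcal{S}_N^{rev}=(s_{N-1},s_{N-2},\ldots,s_0)$ and the $N$th symmetric linear complexity is $L^{sym}(\mathcal{S}_N)=\min\{L(\mathcal{S}_N),L(\mathcal{S}_N^{rev})\}$. The expected values are $$E_N^{lin-exp}=2^{-N}\sum_{\mathcal{S}_N\in\{0,1\}^N}2^{L(\mathcal{S}_N)},\qquad E_N^{lin-exp-sym}=2^{-N}\sum_{\mathcal{S}_N\in\{0,1\}^N}2^{L^{sym}(\mathcal{S}_N)}.$$ *)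

(* Defs.v *)
From mathcomp Require Import all_boot all_order all_algebra.

Set Implicit Arguments.
Unset Strict Implicit.
Unset Printing Implicit Defensive.

Import GRing.Theory.

Local Open Scope ring_scope.

(* The range n = 0, ..., N - L - 1 is 'I_(N - L); it is empty when N <= L, so
   that every L >= N is admissible.  When L < N, n + l < N for all n and l in
   range, so the default value of the subscript s`_(n + l) is never used. *)
Definition satisfies_recurrence (N : nat) (s : N.-tuple 'F_2) (L : nat) : bool :=
  [exists c : L.+1.-tuple 'F_2,
     (tnth c ord_max == 1) &&
     [forall n : 'I_(N - L), \sum_(l < L.+1) tnth c l * s`_(n + l) == 0]].

Lemma satisfies_recurrence_exists (N : nat) (s : N.-tuple 'F_2) :
  exists L, satisfies_recurrence s L.
Proof.
exists N; apply/existsP; exists [tuple 1 | _ < N.+1].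
rewrite tnth_mktuple eqxx /=; apply/forallP => -[n] /=.
by rewrite subnn.
Qed.

Definition lin_complexity (N : nat) (s : N.-tuple 'F_2) : nat :=
  ex_minn (satisfies_recurrence_exists s).

Definition sym_lin_complexity (N : nat) (s : N.-tuple 'F_2) : nat :=
  minn (lin_complexity s) (lin_complexity [tuple of rev s]).

Definition E_lin_exp (R : realFieldType) (N : nat) : R :=
  2 ^- N * \sum_(s : N.-tuple 'F_2) 2 ^+ lin_complexity s.

Definition E_lin_exp_sym (R : realFieldType) (N : nat) : R :=
  2 ^- N * \sum_(s : N.-tuple 'F_2) 2 ^+ sym_lin_complexity s.

(* Main.v *)
(* Let s satisfy, on its first N - 1 terms but not on all N, a recurrence of
   order M < N/2 with characteristic polynomial c, where c(0) = 1.  The jump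
   forces L(s) >= N - M, while the reverse of s satisfies the reversed
   recurrence delayed by one term, so L(rev s) <= M + 1; for 2M + 2 <= N such an s
   contributes at least 2^(N - M - 1) to the sum of 2^L - 2^Lsym.  Such s are
   abundant: take c = X^M + 1 + \sum_(i < k) a_i X^(i + 1).  If two different
   choices of a give the same s, then the first M terms of s satisfy a nonzero
   relation with k coefficients, which at most 2^(3k) initial states do.  Hence
   for M = 3k + 1 there are at least 2^(k + M - 1) such s, and the gain is at
   least 2^(k - 2) with k about N/6, far above the linear bound claimed. *)
Require Import Defs.
From mathcomp Require Import all_boot all_order all_algebra.
From mathcomp Require Import zify lra.

Set Implicit Arguments.
Unset Strict Implicit.
Unset Printing Implicit Defensive.

Import Order.TTheory GRing.Theory Num.Theory.

Local Open Scope ring_scope.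

(** * Linear complexity of a sequence and of its reverse *)

Definition window (c : nat -> 'F_2) (M : nat) (s : seq 'F_2) (n : nat) : 'F_2 :=
  \sum_(i < M.+1) c i * s`_(n + i).

Lemma lin_complexity_le N (s : N.-tuple 'F_2) L (c : nat -> 'F_2) :
  c L = 1 -> (forall n, (n < N - L)%N -> window c L s n = 0) ->
  (lin_complexity s <= L)%N.
Proof.
move=> cL cs; rewrite /lin_complexity; case: ex_minnP => m _; apply.
apply/existsP; exists [tuple c i | i < L.+1].
rewrite tnth_mktuple cL eqxx /=; apply/forallP => n; apply/eqP.
by rewrite -[RHS](cs n) //; apply: eq_bigr => l _; rewrite tnth_mktuple.
Qed.

Lemma lin_complexity_recurrence N (s : N.-tuple 'F_2) :
  exists2 c : nat -> 'F_2, c (lin_complexity s) = 1 &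
    forall n, (n < N - lin_complexity s)%N ->
      window c (lin_complexity s) s n = 0.
Proof.
rewrite /lin_complexity; case: ex_minnP => L /existsP[c /andP[/eqP cL /forallP cs]] _.
exists (nth 0 c) => [|n ltn]; first by rewrite -cL (tnth_nth 0).
rewrite -[RHS](eqP (cs (Ordinal ltn))); apply: eq_bigr => l _.
by rewrite (tnth_nth 0).
Qed.

(* A shorter recurrence, applied in the other order of summation to
   [\sum_i \sum_l c_i c'_l s_(n + i + l)], would force the failing window of
   [c] to vanish. *)
Lemma lin_complexity_ge N (s : N.-tuple 'F_2) M (c : nat -> 'F_2) :
  (M < N)%N ->
  (forall n, (n < N.-1 - M)%N -> window c M s n = 0) ->
  window c M s (N.-1 - M) != 0 ->
  (N - M <= lin_complexity s)%N.
Proof.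
move=> ltMN cs cN; rewrite leqNgt; apply/negP => ltL; move: cN.
have [c'] := lin_complexity_recurrence s.
set L := lin_complexity s in ltL * => c'L c's; case/negP; apply/eqP.
have key : \sum_(l < L.+1) c' l * window c M s (N.-1 - M - L + l) = 0.
  under eq_bigr => l _ do rewrite /window mulr_sumr.
  rewrite exchange_big /= big1 // => i _.
  rewrite -[RHS](mulr0 (c i)) -[in RHS](c's (N.-1 - M - L + i)%N).
    rewrite /window mulr_sumr; apply: eq_bigr => l _.
    by rewrite mulrCA addnAC.
  by have := ltn_ord i; lia.
move: key; rewrite big_ord_recr /= c'L mul1r big1 ?add0r => [<-|l _].
  by congr window; lia.
by rewrite cs ?mulr0 //; have := ltn_ord l; lia.
Qed.

(** Reversing the coefficients makes [c 0 = 1] the leading one. The extra constant coefficient 0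
    skips the first term of the reverse, that is, the last term of [s], the only one at which the
    recurrence may fail. *)
Lemma lin_complexity_rev_le N (s : N.-tuple 'F_2) M (c : nat -> 'F_2) :
  c 0%N = 1 -> (forall n, (n < N.-1 - M)%N -> window c M s n = 0) ->
  (lin_complexity [tuple of rev s] <= M.+1)%N.
Proof.
move=> c0 cs.
apply: (@lin_complexity_le _ _ _ (fun l => if l is 0 then 0 else c (M.+1 - l)%N)).
  by rewrite subnn.
move=> n ltn; rewrite /window big_ord_recl mul0r add0r.
rewrite -[RHS](cs (N.-1 - M - n.+1)%N); last lia.
rewrite (reindex_inj rev_ord_inj) /=; apply: eq_bigr => i _.
have ltiM := ltn_ord i.
rewrite nth_rev size_tuple /bump /=; last lia.
by congr (c _ * s`_ _); lia.
Qed.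

(** As [c M = 1], each new term can be solved for so that its window takes the prescribed value. *)
Lemma exists_extension M (c e : nat -> 'F_2) (u : M.-tuple 'F_2) N :
  c M = 1 -> (M <= N)%N ->
  exists s : N.-tuple 'F_2,
    (forall i, (i < M)%N -> s`_i = u`_i) /\
    (forall n, (n < N - M)%N -> window c M s n = e n).
Proof.
move=> cM; elim: N => [|N IHN] leMN.
  by case: M cM u leMN => // cM u _; exists u; split=> // n; rewrite subnn.
move: leMN; rewrite leq_eqVlt => /predU1P[eqM|leMN].
  by rewrite -eqM; exists u; split=> // n; rewrite subnn.
have [s [su sc]] := IHN leMN.
pose x := e (N - M)%N - \sum_(i < M) c i * s`_(N - M + i).
exists [tuple of rcons s x].
split=> [i ltiM|n ltn]; first by rewrite nth_rcons size_tuple (leq_trans ltiM) // su.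
have [ltn'|len] := ltnP n (N - M).
  rewrite -sc //; apply: eq_bigr => i _.
  by rewrite nth_rcons size_tuple ifT //; have := ltn_ord i; lia.
have -> : n = (N - M)%N by lia.
rewrite /window big_ord_recr /= subnK // cM mul1r.
rewrite nth_rcons size_tuple ltnn eqxx /x addrC -[RHS]addr0 -addrA.
congr (_ + _); rewrite addrC; apply/eqP; rewrite subr_eq0; apply/eqP.
apply: eq_bigr => i _.
by rewrite nth_rcons size_tuple ifT //; have := ltn_ord i; lia.
Qed.

(** * Initial states that satisfy a short relation *)

Definition short_relation M k (b : k.-tuple 'F_2) (u : M.-tuple 'F_2) :=
  [forall n : 'I_(M - k), \sum_(i < k) b`_i * u`_(n.+1 + i) == 0].

Definition degenerate M k (u : M.-tuple 'F_2) :=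
  [exists b : k.-tuple 'F_2, (b != [tuple 0 | _ < k]) && short_relation b u].

Lemma short_relation_inj M k (b : k.-tuple 'F_2) (u v : M.-tuple 'F_2) :
  b != [tuple 0 | _ < k] -> short_relation b u -> short_relation b v ->
  (forall i, (i < k)%N -> u`_i = v`_i) ->
  (forall i, (i < k)%N -> u`_(M - k + i) = v`_(M - k + i)) -> u = v.
Proof.
move=> b0 /forallP bu /forallP bv uvl uvr.
have [j0 bj0] : exists j : 'I_k, b`_j != 0.
  apply/existsP; rewrite -negb_forall; apply: contra b0 => /forallP b0.
  by apply/eqP/eq_from_tnth => j; rewrite tnth_mktuple (tnth_nth 0); apply/eqP.
case: (@arg_maxnP _ j0 (fun j : 'I_k => b`_j != 0) (fun j : 'I_k => j : nat) bj0) => j bj jmax.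
apply/val_inj/(@eq_from_nth _ 0); rewrite ?size_tuple // => m ltmM.
elim/ltn_ind: m ltmM => m IHm ltmM.
have [/uvl //|lekm] := ltnP m k.
have [leMm|ltm] := leqP (M - k) m.
  by have -> : m = (M - k + (m - (M - k)))%N by [lia]; apply: uvr; lia.
have ltj := ltn_ord j.
have ltn : (m - j.+1 < M - k)%N by lia.
have := etrans (eqP (bu (Ordinal ltn))) (esym (eqP (bv (Ordinal ltn)))) => /=.
rewrite (bigD1 j) //= [in RHS](bigD1 j) //=.
have -> : ((m - j.+1).+1 + j = m)%N by lia.
rewrite (_ : \sum_(i < k | i != j) b`_i * u`_((m - j.+1).+1 + i) =
            \sum_(i < k | i != j) b`_i * v`_((m - j.+1).+1 + i)).
  by move/addIr/(mulfI bj).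
apply: eq_bigr => i neij.
have [->|bi] := eqVneq (b`_i) 0; first by rewrite !mul0r.
have : (i <= j)%N := jmax i bi; rewrite leq_eqVlt (inj_eq val_inj) (negPf neij) => ltij.
by rewrite IHm //; lia.
Qed.

Lemma card_F2_tuple n : #|{: n.-tuple 'F_2}| = (2 ^ n)%N.
Proof. by rewrite card_tuple card_Fp. Qed.

(** A degenerate state is encoded by a nonzero relation, its first [k] terms and its last [k] terms:
    [3 * k] bits. *)
Lemma card_degenerate M k :
  (#|[set u : M.-tuple 'F_2 | degenerate k u]| <= 2 ^ (3 * k))%N.
Proof.
have /fin_all_exists[f fP] (u : M.-tuple 'F_2) : exists b : k.-tuple 'F_2,
    degenerate k u -> (b != [tuple 0 | _ < k]) && short_relation b u.
  have [/existsP[b bP]|_] := boolP (degenerate k u); first by exists b.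
  by exists [tuple 0 | _ < k].
pose h u := (f u, [tuple u`_i | i < k], [tuple u`_(M - k + i) | i < k]).
have -> : (2 ^ (3 * k))%N = #|{: k.-tuple 'F_2 * k.-tuple 'F_2 * k.-tuple 'F_2}|.
  by rewrite !card_prod !card_F2_tuple -!expnD; congr expn; lia.
rewrite -(@card_in_imset _ _ h) ?max_card // => u v.
rewrite !inE => /fP/andP[fu0 fu] /fP/andP[_ fv] [fE hl hr].
apply: (short_relation_inj fu0 fu); first by rewrite fE.
  by move=> i ltik; apply: (eq_in_map _ _ _).2 hl (Ordinal ltik) (mem_enum _ _).
by move=> i ltik; apply: (eq_in_map _ _ _).2 hr (Ordinal ltik) (mem_enum _ _).
Qed.

(** * Counting sequences whose recurrence fails only at the last term *)

(* The characteristic polynomial [X^M + \sum_i a_i X^(i+1) + 1]. *)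
Definition coeffs M (a : seq 'F_2) (i : nat) : 'F_2 :=
  if (i == 0) || (i == M) then 1 else a`_i.-1.

Lemma window_coeffs M k (a : k.-tuple 'F_2) s n : (k < M)%N ->
  window (coeffs M a) M s n =
    s`_n + \sum_(i < k) a`_i * s`_(n.+1 + i) + s`_(n + M).
Proof.
move=> ltkM; rewrite /window big_ord_recr /= {2}/coeffs eqxx orbT mul1r.
congr (_ + _); case: M ltkM => // M ltkM.
rewrite big_ord_recl /coeffs /= mul1r addn0; congr (_ + _).
rewrite (big_ord_widen M (fun i => a`_i * s`_(n.+1 + i)) ltkM) [RHS]big_mkcond /=.
apply: eq_bigr => i _; rewrite /bump /= add1n eqSS.
rewrite ltn_eqF ?ltn_ord // addSnnS.
by case: ltnP => // lei; rewrite nth_default ?mul0r // size_tuple.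
Qed.

Definition asymmetric N M (s : N.-tuple 'F_2) :=
  (N - M <= lin_complexity s)%N && (lin_complexity [tuple of rev s] <= M.+1)%N.

Lemma card_asymmetric N M k : (k < M)%N -> (2 * M < N)%N ->
  (2 ^ k * (2 ^ M - 2 ^ (3 * k)) <= #|[set s : N.-tuple 'F_2 | asymmetric M s]|)%N.
Proof.
move=> ltkM ltMN.
(* The only nonzero window is the last one, which ends at the last term of [s]. *)
pose e n : 'F_2 := (n == N.-1 - M)%N%:R.
have /fin_all_exists[f fP] (p : k.-tuple 'F_2 * M.-tuple 'F_2) :
  exists s : N.-tuple 'F_2, (forall i, (i < M)%N -> s`_i = p.2`_i) /\
    (forall n, (n < N - M)%N -> window (coeffs M p.1) M s n = e n).
  apply: exists_extension; last lia.
  by rewrite /coeffs eqxx orbT.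
pose D := setX [set: k.-tuple 'F_2] (~: [set u : M.-tuple 'F_2 | degenerate k u]).
have cardD : (2 ^ k * (2 ^ M - 2 ^ (3 * k)) <= #|D|)%N.
  rewrite cardsX cardsT card_F2_tuple leq_mul2l cardsCs setCK card_F2_tuple.
  by rewrite leq_sub2l ?orbT // card_degenerate.
apply: leq_trans cardD _; rewrite -(@card_in_imset _ _ f D).
  apply/subset_leq_card/subsetP => s /imsetP[p _ ->]; rewrite inE.
  have [_ fw] := fP p.
  have fw0 n : (n < N.-1 - M)%N -> window (coeffs M p.1) M (f p) n = 0.
    by move=> ltn; rewrite fw /e ?ltn_eqF //; lia.
  apply/andP; split; last by apply: (lin_complexity_rev_le _ fw0).
  apply: (lin_complexity_ge _ fw0); first lia.
  by rewrite fw /e ?eqxx ?oner_eq0 //; lia.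
move=> [a u] [a' u'] _; rewrite !inE /= => ndu' fE.
have [fu fw] := fP (a, u); have [fu' fw'] := fP (a', u'); rewrite /= in fu fw fu' fw'.
have uu' : u = u'.
  apply/val_inj/(@eq_from_nth _ 0); rewrite ?size_tuple // => i lti.
  by rewrite -fu // -fu' // fE.
congr pair => //; apply/eqP; apply: contraR ndu' => neaa'.
(* Subtracting the two recurrences cancels [s]_n[and]s[_(n + M)]; for [n < M - k] the remaining
   indices [n.+1 + i] are below [M], so the relation concerns the initial state alone. *)
apply/existsP; exists [tuple a`_i - a'`_i | i < k]; apply/andP; split.
  apply: contra neaa' => /eqP aa'; apply/eqP/eq_from_tnth => i.
  have := congr1 (fun t => tnth t i) aa'; rewrite /= !tnth_mktuple.
  by move/eqP; rewrite subr_eq0 -!tnth_nth => /eqP.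
apply/forallP => n; have ltn := ltn_ord n.
have ltnN : (n < N - M)%N by lia.
have := etrans (fw n ltnN) (esym (fw' n ltnN)).
rewrite -fE !window_coeffs // => /addIr/addrI/eqP.
rewrite -subr_eq0 -sumrB => /eqP sum0; apply/eqP; rewrite -[RHS]sum0.
apply: eq_bigr => i _; have lti := ltn_ord i.
rewrite -tnth_nth tnth_mktuple -mulrBl -uu' fu //; lia.
Qed.

(** * From the count to the expected values *)

Lemma E_lin_exp_gain (R : realFieldType) N M k :
  (3 * k < M)%N -> (2 * M + 2 <= N)%N ->
  2 ^+ k / 4 <= E_lin_exp R N - E_lin_exp_sym R N.
Proof.
move=> ltkM leMN; rewrite /E_lin_exp /E_lin_exp_sym -mulrBr -sumrB.
have gain : #|[set s : N.-tuple 'F_2 | asymmetric M s]|%:R * 2 ^+ (N - M - 1) <=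
  \sum_(s : N.-tuple 'F_2) (2 ^+ lin_complexity s - 2 ^+ sym_lin_complexity s) :> R.
  rewrite mulr_natl -sumr_const big_mkcond /=; apply: ler_sum => s _.
  rewrite /sym_lin_complexity inE; case: ifP => [/andP[ge le]|_]; last first.
    by rewrite subr_ge0 ler_weXn2l ?ler1n ?geq_minl.
  rewrite lerBrDr.
  (* Here [2 ^ L] is at least twice [2 ^ (N - M - 1)], while the symmetric term is at most
     [2 ^ (M + 1)], hence at most [2 ^ (N - M - 1)]. *)
  have leE : 2 ^+ (N - M - 1).+1 <= 2 ^+ lin_complexity s :> R.
    by rewrite ler_weXn2l ?ler1n //; lia.
  apply: le_trans leE; rewrite exprS mulr_natl [leRHS]mulr2n lerD2l.
  rewrite ler_weXn2l ?ler1n // geq_min; apply/orP; right.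
  by apply: leq_trans le _; lia.
(* Since [3 * k <= M - 1], at least half of the initial states are not degenerate. *)
have card : (2 ^ (k + M - 1) <= #|[set s : N.-tuple 'F_2 | asymmetric M s]|)%N.
  apply: leq_trans (@card_asymmetric N M k _ _); [|lia|lia].
  have -> : (k + M - 1 = k + M.-1)%N by lia.
  rewrite expnD leq_mul2l; apply/orP; right.
  have : (2 ^ (3 * k) <= 2 ^ M.-1)%N by rewrite leq_exp2l //; lia.
  by case: (M) ltkM => // m _ /=; rewrite expnS; lia.
rewrite [leRHS]mulrC ler_pdivlMr ?exprn_gt0 //; apply: le_trans gain.
move: card; rewrite -(ler_nat R) natrX => card.
apply: le_trans (ler_wpM2r (exprn_ge0 _ (ler0n _ _)) card).
rewrite -exprD (_ : k + M - 1 + (N - M - 1) = k + N - 2)%N; last lia.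
rewrite mulrAC ler_pdivrMr ?ltr0n // -exprD (natrX R 2 2) -exprD.
by rewrite ler_weXn2l ?ler1n //; lia.
Qed.

Lemma E_lin_exp_sym_le (R : realFieldType) N : E_lin_exp_sym R N <= E_lin_exp R N.
Proof.
rewrite ler_wpM2l ?invr_ge0 ?exprn_ge0 ?ler0n //; apply: ler_sum => s _.
by rewrite ler_weXn2l ?ler1n // geq_minl.
Qed.

Lemma linear_le_exp2 k : (18 * k <= 2 ^ k + 93)%N.
Proof.
have [ltk|/subnKC <-] := ltnP k 6; first lia.
by rewrite expnD; have := ltn_expl (k - 6) (ltnSn 1); lia.
Qed.

Theorem proposition3 (R : realFieldType) :
  exists C : R, forall N : nat, (0 < N)%N ->
    E_lin_exp_sym R N <= E_lin_exp R N - 3 * N%:R / 4 + C.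
Proof.
(* The constant is [120 / 4], from [3 * N <= 2 ^ k + 120] below. *)
exists 30 => N _; have [ltN|leN] := ltnP N 4.
  have := E_lin_exp_sym_le R N; move: ltN; rewrite -(ltr_nat R); lra.
(* The largest [k] for which [M = 3 * k + 1] satisfies [2 * M + 2 <= N]; then [N <= 6 * k + 9], so
   [3 * N <= 18 * k + 27]. *)
pose k := ((N - 4) %/ 6)%N.
have := @E_lin_exp_gain R N (3 * k).+1 k (ltnSn _).
have -> : (2 * (3 * k).+1 + 2 <= N)%N by rewrite /k; lia.
move=> /(_ isT).
have leNk : (3 * N <= 2 ^ k + 120)%N by have := linear_le_exp2 k; rewrite /k; lia.
move: leNk; rewrite -(ler_nat R) natrD natrM natrX; lra.
Qed.
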